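(* Let $G$ be a cactus on $n$ vertices, where $n\geq 3$. (i) If $n$ is odd, then $q(G)\leq\frac{(n+2)+\sqrt{n^2-4n+12}}{2}$, with equality if and only if $G \cong H_{\frac{n-1}{2}}^0$. (ii) If $n$ is even, then $q(G)\leq\frac{(n+1)+\sqrt{n^2-2n+9}}{2}$, with equality if and only if $G \cong H_{\frac{n}{2}-1}^1$.
   Context: All graphs are finite, undirected and simple (no loops or multiple edges). A graph $G$ is a cactus if it is connected and any two of its cycles have at most one common vertex. For a graph $G$ on vertices $v_1,\dots,v_n$ with degrees $d_1,\dots,d_n$ and adjacency matrix $A(G)$, the signless Laplacian matrix is $Q(G)=\mathrm{diag}(d_1,\dots,d_n)+A(G)$, and $q(G)$ denotes its largest eigenvalue (the signless Laplacian spectral radius of $G$). For nonnegative integers $s,k$, $H_s^k$ is the graph on $2s+k+1$ vertices consisting of $s$ triangles that all share one common vertex $v_0$ (and are otherwise disjoint), together with $k$ pendant vertices each adjacent only to $v_0$. *)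

(* Defs.v *)
From HB Require Import structures.
(* In this order [set0], [setT], ... are those of finset, as the graphs are finite. *)
From mathcomp Require Export classical_sets reals.
From mathcomp Require Export all_boot all_order all_algebra.
From mathcomp Require complex polyrcf.

Set Implicit Arguments.
Unset Strict Implicit.
Unset Printing Implicit Defensive.

Export Order.TTheory GRing.Theory Num.Theory.
Global Open Scope ring_scope.

Record sgraph (T : finType) := SGraph {
  adj :> rel T;
  adj_sym : symmetric adj;
  adj_irrefl : irreflexive adj }.

Section Graphs.
Variable T : finType.
Implicit Type G : sgraph T.

Definition graph_connected G : Prop := forall x y : T, connect G x y.

(* In a simple graph a closed walk without repeated vertices is a cycle only
   if it has length at least 3; [ucycle] alone also accepts the lengths 0
   and 2. *)
Definition is_cycle G (s : seq T) : bool := ucycleb G s && (2 < size s)%N.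

(* The same cycle of G is listed by several sequences (rotations, reversal);
   two of them describe the same subgraph iff they have the same edges. *)
Definition cycle_edges (s : seq T) : {set {set T}} :=
  [set [set x; next s x] | x in s].

Definition cactus G : Prop :=
  graph_connected G /\
  forall s1 s2 : seq T, is_cycle G s1 -> is_cycle G s2 ->
    cycle_edges s1 != cycle_edges s2 ->
    (#|[set x | (x \in s1) && (x \in s2)]| <= 1)%N.

Definition degree G (x : T) : nat := #|[set y | G x y]|.

End Graphs.

Definition graph_iso (T U : finType) (G : sgraph T) (H : sgraph U) : Prop :=
  exists f : T -> U, bijective f /\ forall x y : T, H (f x) (f y) = G x y.

(* H_s^k: the common vertex v_0 is [None], the i-th triangle is
   {None, Some (inl (i, false)), Some (inl (i, true))}, and the pendant
   vertices are the [Some (inr j)]. *)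
Definition H_vertex (s k : nat) : finType := option ('I_s * bool + 'I_k)%type.

Definition H_adj (s k : nat) : rel (H_vertex s k) := fun x y =>
  match x, y with
  | None, Some _ | Some _, None => true
  | Some (inl (i, b)), Some (inl (j, c)) => (i == j) && (b != c)
  | _, _ => false
  end.
Arguments H_adj : clear implicits.

Lemma H_adj_sym (s k : nat) : symmetric (H_adj s k).
Proof.
by move=> [[[i b]|i]|] [[[j c]|j]|] //=; rewrite eq_sym (eq_sym b).
Qed.

Lemma H_adj_irrefl (s k : nat) : irreflexive (H_adj s k).
Proof. by move=> [[[i b]|i]|] //=; rewrite eqxx eqxx andbF. Qed.

Definition Hgraph (s k : nat) : sgraph (H_vertex s k) :=
  SGraph (@H_adj_sym s k) (@H_adj_irrefl s k).

Section SignlessLaplacian.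
Variables (R : realType) (n : nat).
Implicit Type G : sgraph 'I_n.

Definition adjacency_mx G : 'M[R]_n := \matrix_(i, j) (G i j)%:R.

Definition degree_mx G : 'M[R]_n := diag_mx (\row_i (degree G i)%:R).

Definition signless_laplacian G : 'M[R]_n := degree_mx G + adjacency_mx G.

(* By [signless_radiusP] below, this supremum is a maximum. *)
Definition signless_radius G : R :=
  sup [set a : R | eigenvalue (signless_laplacian G) a]%classic.

Lemma signless_laplacian_sym G : (signless_laplacian G)^T = signless_laplacian G.
Proof.
apply/matrixP => i j; rewrite !mxE adj_sym eq_sym.
by case: eqVneq => [->|].
Qed.

End SignlessLaplacian.

Arguments adjacency_mx R {n} G.
Arguments degree_mx R {n} G.
Arguments signless_laplacian R {n} G.
Arguments signless_radius R {n} G.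

Section LargestEigenvalue.
Import complex polyrcf.
Variable R : realType.
Local Notation toC := (real_complex R).

Lemma sym_eigenvalue_exists n (A : 'M[R]_n) : (0 < n)%N -> A^T = A ->
  exists a : R, eigenvalue A a.
Proof.
move=> n_gt0 symA; pose B := map_mx toC A.
have [a /eigenvalueP[v vB v0]] : exists a, eigenvalue B a.
  have : size (char_poly B) != 1 by rewrite size_char_poly eqSS -lt0n.
  by move/closed_rootP => [a ra]; exists a; rewrite eigenvalue_root_char.
pose w := (map_mx Num.conj v)^T; pose s := (v *m B *m w) 0 0.
pose t := \sum_i `|v 0 i| ^+ 2.
have st : s = a * t.
  rewrite /s vB -scalemxAl mxE; congr (_ * _); rewrite mxE.
  by apply: eq_bigr => i _; rewrite !mxE normCK.
have Bc : map_mx Num.conj B = B.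
  apply/matrixP => i j; rewrite !mxE; apply/eqP; rewrite -CrealE.
  by apply/complex_realP; eexists.
have sr : s \is Num.real.
  rewrite CrealE; apply/eqP.
  have -> : Num.conj s = (map_mx Num.conj (v *m B *m w))^T 0 0.
    by rewrite [RHS]mxE [RHS]mxE.
  rewrite !map_mxM !trmx_mul Bc /= /w.
  rewrite -[map_mx _ (_^T)]map_trmx trmxK.
  have -> : map_mx Num.conj (map_mx Num.conj v) = v.
    by apply/matrixP => i j; rewrite !mxE conjCK.
  have -> : B^T = B by rewrite /B map_trmx symA.
  by rewrite /s mulmxA.
have tr : t \is Num.real by apply: rpred_sum => i _; rewrite rpredX ?normr_real.
have t0 : t != 0.
  apply: contra v0; rewrite psumr_eq0 => [/allP h|i _]; last by rewrite exprn_ge0.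
  apply/eqP/rowP => i; rewrite mxE; apply/eqP.
  by have := h i (mem_index_enum i); rewrite expf_eq0 normr_eq0.
have ar : a \is Num.real.
  by rewrite -(mulfK t0 a) -st rpred_div.
exists (complex.Re a); rewrite -(eigenvalue_map toC).
by rewrite /= RRe_real //; apply/eigenvalueP; exists v.
Qed.

Lemma eigenvalue_max n (A : 'M[R]_n) : (exists a, eigenvalue A a) ->
  exists2 q, eigenvalue A q & forall a, eigenvalue A a -> a <= q.
Proof.
have eigE a : eigenvalue A a = (a \in rootsR (char_poly A)).
  rewrite eigenvalue_root_char -(roots_on_rootsR _ a) ?inE //.
  by rewrite monic_neq0 // char_poly_monic.
have maxs (s : seq R) a : a \in s ->
    exists2 q, q \in s & forall b, b \in s -> b <= q.
  move: a; elim: s => // x [|y s] IH a _.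
    by exists x; rewrite ?mem_head // => b; rewrite inE => /eqP->.
  have [q qs qmax] := IH y (mem_head _ _).
  have [xq|qx] := leP x q.
    exists q; first by rewrite inE qs orbT.
    by move=> b; rewrite inE => /orP[/eqP->//|/qmax].
  exists x; first exact: mem_head.
  by move=> b; rewrite inE => /orP[/eqP->//|/qmax bq]; apply: le_trans (ltW qx).
move=> [a]; rewrite eigE => /maxs [q qs qmax].
by exists q => [|b]; rewrite eigE //; apply: qmax.
Qed.

Lemma signless_radiusP n (G : sgraph 'I_n) : (0 < n)%N ->
  eigenvalue (signless_laplacian R G) (signless_radius R G) /\
  forall a, eigenvalue (signless_laplacian R G) a -> a <= signless_radius R G.
Proof.
move=> n_gt0.
have [q eq qmax] := eigenvalue_max
  (sym_eigenvalue_exists n_gt0 (signless_laplacian_sym R G)).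
suff -> : signless_radius R G = q by [].
apply/le_anti/andP; split; first by apply: ge_sup; [exists q|].
by apply: ub_le_sup => //; exists q.
Qed.

End LargestEigenvalue.

(* Main.v *)
Require Import Defs.
From mathcomp Require Import ring lra zify.

Set Implicit Arguments.
Unset Strict Implicit.
Unset Printing Implicit Defensive.

(** If [x] is an eigenvector of the signless Laplacian for the value [q], then
    [q * \sum_v x v ^+ 2] is the sum of [(x u + x v) ^+ 2] over the edges, and
    passing to [y v = `|x v|] does not decrease this sum. So it suffices to
    bound the sum over the edges (the energy of [y]) for [y >= 0], and to study
    the case of equality.

    Let [r] be a vertex where [y] is maximal. The edges of a cactus can be moved
    without decreasing the energy, so that each [v != r] gets an edge to [r] and
    the remaining edges form a matching [m] of vertices other than [r]. This is
    done by peeling ([leaf_or_ear]): look at the end [v] of a longest path from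
    [r]. Either some vertex of degree one can be removed, and its edge be moved
    to [r]; or [v] has degree two and is the bottom of a cycle [v, b, .., a]
    where [b] has degree two as well. Then [v] and [b] are removed, [{v, b}] is
    put in the matching, and the edges [{v, a}] and [{b, c}], with [c] the other
    neighbour of [b], are moved to [{v, r}] and [{b, r}]. All this uses of a
    cactus is that two cycles with two common vertices have the same vertices.
    The result is [cactus_dominates], where moreover the matched edges are
    bounded by [(y v + y b) ^+ 2 <= 2 * y v ^+ 2 + 2 * y b ^+ 2].

    The resulting bound is a quadratic form in which [y v], for [v != r], only
    interacts with [y r]. Completing the squares ([star_energy_gap]) shows that
    it is at most [lam * \sum_v y v ^+ 2] as soon as [lam] is at least the sum
    over [v != r] of [1 + (lam - c) ^-1], where [c] is 3 if [v] is matched and 1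
    otherwise. For the largest possible matching, which misses [k] of the
    vertices other than [r] with [k = 0] or [k = 1] by parity, equality holds
    here exactly for the [lam] of the extremal graph.

    If the bound is attained, then exactly [k] vertices are unmatched and
    [y v = y r / (lam - c)] for [v != r]. If there are at least four vertices,
    then [y v < y r], so that a decrease of [y r] is allowed and would violate
    the inequality unless every vertex is adjacent to [r] ([tight_adjacent]). A
    cactus with such a vertex [r] has no other edges away from [r] than the
    matched ones ([hub_adjE]), hence is the extremal graph. Conversely the extremal graph has
    the eigenvalue [lam], with an explicit eigenvector. *)

(** * Cycles sharing two vertices *)

Section Cycles.
Variables (T : finType) (G : sgraph T).
Implicit Types (S : {set T}) (p s : seq T).

Lemma cover_cycle_edges s : cover (cycle_edges s) = [set x in s].
Proof.
apply/setP => x; rewrite inE; apply/bigcupP/idP.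
  by case=> e /imsetP [z zs ->]; rewrite !inE => /orP[] /eqP ->; rewrite ?mem_next.
by move=> xs; exists [set x; next s x]; [apply: imset_f | rewrite !inE eqxx].
Qed.

(** The edges of a cycle determine its vertices, so cycles with different
    vertices fall under the definition of a cactus. *)
Lemma cactus_same_cycle s1 s2 x y : cactus G -> is_cycle G s1 -> is_cycle G s2 ->
  x != y -> x \in s1 -> x \in s2 -> y \in s1 -> y \in s2 -> s1 =i s2.
Proof.
move=> [_ cG] c1 c2 xy x1 x2 y1 y2.
have [e12 z|e12] := eqVneq (cycle_edges s1) (cycle_edges s2).
  have /setP/(_ z) : [set x in s1] = [set x in s2].
    by rewrite -!cover_cycle_edges e12.
  by rewrite !inE.
have := cG _ _ c1 c2 e12; rewrite leqNgt => /negP[]; apply/card_gt1P.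
by exists x, y; rewrite !inE x1 x2 y1 y2.
Qed.

Lemma chord_cycle x b a p : path G x (b :: p) -> uniq [:: x, b & p] ->
  a \in p -> G x a -> is_cycle G [:: x, b & take (index a p).+1 p].
Proof.
move=> pxp uxp ap xa.
have u : uniq [:: x, b & take (index a p).+1 p].
  by have := take_uniq (index a p).+3 uxp.
have ltap : (index a p < size p)%N by rewrite index_mem.
rewrite /is_cycle /ucycleb u andbT /= size_take_min rcons_path.
rewrite [last _ _](_ : _ = a); last first.
  by rewrite (take_nth a) // last_rcons nth_index.
have /andP[-> pbp] := pxp; rewrite (adj_sym G a) xa take_path //=; lia.
Qed.

(** Two such chords would close two cycles through [x] and [b], one of them
    missing the end of the longer chord. *)
Lemma chord_uniq x b p a a' : cactus G -> path G x (b :: p) ->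
  uniq [:: x, b & p] -> a \in p -> G x a -> a' \in p -> G x a' -> a = a'.
Proof.
move=> cG pxp uxp ap xa a'p xa'.
have c1 := chord_cycle pxp uxp ap xa; have c2 := chord_cycle pxp uxp a'p xa'.
have xb : x != b by move: uxp; rewrite /= inE negb_or => /andP[/andP[]].
have s12 : [:: x, b & take (index a p).+1 p] =i [:: x, b & take (index a' p).+1 p].
  by apply: (cactus_same_cycle cG c1 c2 xb); rewrite !inE eqxx ?orbT.
have := perm_size (uniq_perm _ _ s12).
move: c1 c2 => /andP[/andP[_ u1] _] /andP[/andP[_ u2] _] /(_ u1 u2) /=.
rewrite !size_take_min; move: (ap) (a'p); rewrite -!index_mem => ia ia' e.
have ii : index a p = index a' p.
  by move: (index a p) (index a' p) (size p) ia ia' e => i j k; lia.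
by rewrite -[LHS](nth_index a ap) ii nth_index.
Qed.

(** The two cycles share [b] and [c], hence have the same vertices; but [x']
    is the only vertex of the second one that does not come from [b, c & p]. *)
Lemma fork_unique x x' b c p a a' : cactus G ->
  path G x [:: b, c & p] -> uniq [:: x, b, c & p] ->
  a \in c :: p -> G x a ->
  path G x' [:: b, c & p] -> uniq [:: x', b, c & p] ->
  a' \in c :: p -> G x' a' -> x = x'.
Proof.
move=> cG px ux ap xa px' ux' a'p xa'.
have c1 := chord_cycle px ux ap xa; have c2 := chord_cycle px' ux' a'p xa'.
have bc : b != c.
  by move: ux; rewrite /= !inE !negb_or => /and3P[_ /andP[-> _]].
have hc d : c \in take (index d (c :: p)).+1 (c :: p) by rewrite /= inE eqxx.
have /(_ x) : [:: x, b & take (index a (c :: p)).+1 (c :: p)]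
    =i [:: x', b & take (index a' (c :: p)).+1 (c :: p)].
  by apply: (cactus_same_cycle cG c1 c2 bc); rewrite !in_cons ?hc ?eqxx ?orbT.
rewrite mem_head => /esym.
rewrite (in_cons x') (in_cons b) => /orP[/eqP //|/orP[/eqP xb|xc]].
  by move: ux; rewrite /= xb inE eqxx.
by case/andP: ux => /negP[]; rewrite in_cons (mem_take xc) orbT.
Qed.

(** The cycles closed by the chords at [x] and at [b] share [b] and [c], but
    only the first one contains [x]. *)
Lemma stacked_chords_absurd x b c p a d : cactus G ->
  path G x [:: b, c & p] -> uniq [:: x, b, c & p] ->
  a \in c :: p -> G x a -> d \in p -> G b d -> False.
Proof.
move=> cG px ux ap xa dp bd.
have c1 := chord_cycle px ux ap xa.
have c2 : is_cycle G [:: b, c & take (index d p).+1 p].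
  by apply: chord_cycle => //; [case/andP: px | case/andP: ux].
have bc : b != c.
  by move: ux; rewrite /= !inE !negb_or => /and3P[_ /andP[-> _]].
have hc d' : c \in take (index d' (c :: p)).+1 (c :: p) by rewrite /= inE eqxx.
have /(_ x) : [:: x, b & take (index a (c :: p)).+1 (c :: p)]
    =i [:: b, c & take (index d p).+1 p].
  by apply: (cactus_same_cycle cG c1 c2 bc); rewrite !in_cons ?hc ?eqxx ?orbT.
rewrite mem_head => /esym; rewrite (in_cons b) (in_cons c) => xin.
case/andP: ux => /negP[]; rewrite !inE.
case/or3P: xin => [->//|->|/mem_take ->]; by rewrite !orbT.
Qed.

End Cycles.

(** * Peeling a cactus from its longest paths *)

Section Peeling.
Variables (T : finType) (G : sgraph T).
Implicit Types (S D : {set T}) (p : seq T).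

Definition induced S x y := [&& G x y, x \in S & y \in S].
Arguments induced S x y /.

Definition reachable_in S r := forall u, u \in S -> connect (induced S) r u.

(** The path is listed from its far end [x] back to [r], so that the vertex
    to be peeled is at the head of the list. *)
Definition rooted_path S r x p :=
  [&& path G x p, uniq (x :: p), all (mem S) (x :: p) & last x p == r].

Lemma connect_induced_sym S : connect_sym (induced S).
Proof.
by apply: sym_connect_sym => x y; rewrite /= adj_sym [(x \in S) && _]andbC.
Qed.

(** A path that avoids [D] at its end can be cut at its last visit to [D]: the
    vertex through which it leaves is connected to [r] by hypothesis. *)
Lemma reachable_setD S D r : r \in S -> r \notin D -> reachable_in S r ->
  (forall w z, w \in S :\: D -> z \in D -> G w z ->
     connect (induced (S :\: D)) r w) ->
  reachable_in (S :\: D) r.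
Proof.
move=> rS rD reachS hD u uSD; have uS : u \in S by move: uSD; rewrite inE => /andP[].
have /connectP [p pp uE] := reachS u uS; rewrite uE in uSD *.
elim/last_ind: p pp {u uE uS} uSD => [//|p z IH].
rewrite rcons_path last_rcons => /andP[pp /and3P[lz lS zS]] zSD.
have [lD|lD] := boolP (last r p \in D).
  by apply: (hD _ (last r p)) => //; rewrite adj_sym.
have lSD : last r p \in S :\: D by rewrite inE lD.
by apply: connect_trans (IH pp lSD) (connect1 _); rewrite /= lz lSD.
Qed.

Lemma rooted_path_connect S r x p y : path G x p -> all (mem S) (x :: p) ->
  last x p = r -> y \in x :: p -> connect (induced S) r y.
Proof.
elim: p x y => [|z p IH] x y /=; first by move=> _ _ ->; rewrite inE => /eqP ->.
case/andP=> xz pzp /andP[xS allS] lr.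
have hz y' := IH z y' pzp allS lr.
rewrite inE => /orP[/eqP -> | /hz //].
apply: (connect_trans (hz z (mem_head _ _))); apply: connect1.
by move: allS => /= /andP[zS _]; rewrite adj_sym xz zS.
Qed.

Lemma longest_rooted_path S r : r \in S -> exists x p, rooted_path S r x p /\
  forall x' p', rooted_path S r x' p' -> (size p' <= size p)%N.
Proof.
move=> rS.
pose P k := [exists x, exists p : k.-tuple T, rooted_path S r x p].
have PI x p : rooted_path S r x p -> P (size p).
  by move=> rp; apply/existsP; exists x; apply/existsP; exists (in_tuple p).
have exP : exists k, P k.
  by exists 0%N; apply: (PI r [::]); rewrite /rooted_path /= rS eqxx.
have ubP k : P k -> (k <= #|T|)%N.
  case/existsP => x /existsP[p /and4P[_ /card_uniqP u _ _]].
  by have := max_card [in x :: p]; rewrite u /= size_tuple => /ltnW.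
have [k /existsP[x /existsP[p rp]] kmax] := ex_maxnP exP ubP.
by exists x, p; split=> // x' p' /PI /kmax; rewrite size_tuple.
Qed.

(** A neighbour outside of the path would extend it. *)
Lemma longest_path_end S r x b p : rooted_path S r x (b :: p) ->
  (forall x' p', rooted_path S r x' p' -> (size p' <= size (b :: p))%N) ->
  forall z, z \in S -> G x z -> z \in b :: p.
Proof.
move=> /and4P[pp up Sp lp] pmax z zS xz; apply/negPn/negP => zp.
have /pmax : rooted_path S r z [:: x, b & p]; last by rewrite /= ltnn.
rewrite /rooted_path [uniq _]/(_ && uniq (x :: b :: p)) up /=.
move: pp Sp lp => /= -> /= -> ->; rewrite adj_sym xz zS !andbT /=.
by rewrite inE negb_or zp andbT; case: eqP xz => // ->; rewrite adj_irrefl.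
Qed.

Definition leaf_at S r u b := [/\ u \in S :\ r, b \in S,
  [set z in S | G u z] = [set b] & reachable_in (S :\ u) r].

(** The vertices [v] and [b] are consecutive on a cycle, [a] is the other
    neighbour of [v] on it and [c] the other neighbour of [b]; on a triangle [a]
    and [c] coincide. *)
Definition ear_at S r v b a c := [/\ v \in S :\ r /\ b \in S :\ r,
  a != b /\ c != v, [set z in S | G v z] = [set b; a],
  [set z in S | G b z] = [set v; c] & reachable_in (S :\: [set v; b]) r].

(** All the neighbours of the end [x] of a longest path are on the path, and
    besides the next vertex [b] there is at most one of them, since two chords
    at [x] would give two cycles with two common vertices. If there is one, then
    [b] has no chord either. A neighbour [u] of [b] off the path is the end of
    another longest path, and it has no chord since the two cycles would share
    [b] and [c]: then [u] is a leaf. If there is no such [u], then [x] and [b]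
    have degree two. *)
Lemma leaf_or_ear S r : cactus G -> r \in S -> (1 < #|S|)%N ->
  reachable_in S r ->
  (exists u b, leaf_at S r u b) \/ (exists v b a c, ear_at S r v b a c).
Proof.
move=> cG rS S1 reachS.
have [x [[|b p] [rp pmax]]] := longest_rooted_path rS.
  have /subsetPn [u uS /=] : ~~ (S \subset [set r]).
    by apply: contraL S1 => /subset_leq_card; rewrite cards1 -leqNgt.
  rewrite inE => ur; have /connectP [[|z q] /= pq uE] := reachS u uS.
    by rewrite uE eqxx in ur.
  case/andP: pq => /and3P[rz _ zS] _.
  have /pmax // : rooted_path S r z [:: r].
  rewrite /rooted_path /= adj_sym rz zS rS eqxx inE !andbT.
  by apply: contraTneq rz => ->; rewrite adj_irrefl.
have leafP u : rooted_path S r u (b :: p) ->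
    (forall z, z \in S -> G u z -> z = b) -> leaf_at S r u b.
  move=> /and4P[pp up Sp lp] ub.
  have [uS [bS /= Sp']] : u \in S /\ b \in S /\ all (mem S) (b :: p).
    by move: Sp => /= /and3P[-> -> ->].
  have ru : r \notin [set u].
    rewrite inE -(eqP lp); case/andP: up => /negP uNbp _.
    by apply/eqP => rE; apply: uNbp; rewrite -rE /= mem_last.
  split=> //; first by rewrite in_setD1 uS andbT eq_sym -in_set1.
    apply/setP => z; rewrite !inE; apply/andP/eqP => [[zS uz]|->].
      exact: ub.
    by split=> //; case/andP: pp.
  apply: reachable_setD => // w z wSu; rewrite inE => /eqP ->; rewrite adj_sym.
  move: (wSu); rewrite inE => /andP[_ wS] uw; rewrite (ub w wS uw).
  apply: (@rooted_path_connect _ _ b p); rewrite ?mem_head //; last by apply/eqP.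
    by case/andP: pp.
  apply/allP => t tp; have tS : t \in S := allP (Sp' : all (mem S) (b :: p)) t tp.
  rewrite !inE tS andbT.
  by case/andP: up => uNbp _; apply: contraNneq uNbp => <-.
have endP u q : rooted_path S r u q -> size q = size (b :: p) ->
  forall z, z \in S -> G u z -> z \in q.
  case: q => // d q rq sq; apply: longest_path_end rq _ => ? ?; rewrite sq.
  exact: pmax.
have noother u : [pred z | [&& z \in S, G u z & z != b]] =1 pred0 ->
    forall z, z \in S -> G u z -> z = b.
  by move=> h z zS uz; have := h z; rewrite /= zS uz /= => /negbFE/eqP.
(* A second neighbour [a] of the end [x] closes a cycle through [b]. *)
case: (pickP [pred z | [&& z \in S, G x z & z != b]]) => [a|]; last first.
  by move=> /noother h; left; exists x, b; apply: leafP.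
case/and3P=> aS xa ab.
have := endP _ _ rp erefl a aS xa; rewrite inE (negPf ab) /= => ap.
case: p => [//|c q] in rp pmax leafP endP ap *.
case/and4P: (rp) => pp up Sp lp.
case: (pickP [pred z | [&& z \in S, G b z, z != x & z != c]]) => [u|noU]; last first.
  right; exists x, b, a, c.
  have bcq : b \notin c :: q by case/and3P: up.
  have xbcq : x \notin [:: b, c & q] by case/and3P: up.
  have [xS [bS cqS]] : x \in S /\ b \in S /\ all (mem S) (c :: q).
    by move: Sp => /= /and4P[-> -> -> ->].
  have [xb [bc pcq]] : G x b /\ G b c /\ path G c q.
    by move: pp => /= /and3P[-> -> ->].
  have rcq : r \in c :: q by rewrite -(eqP lp) /= mem_last.
  have sub D : D = [set x; b] -> all (mem (S :\: D)) (c :: q).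
    move=> ->; apply/allP => t tq; have tS : t \in S := allP cqS t tq.
    rewrite !inE tS andbT negb_or.
    apply/andP; split.
      by apply: contraNneq xbcq => <-; rewrite inE tq orbT.
    by apply: contraNneq bcq => <-.
  have nx : [set z in S | G x z] = [set b; a].
    apply/setP => z; rewrite !inE; apply/andP/orP => [[zS xz]|].
      have := endP _ _ rp erefl z zS xz; rewrite inE => /orP[->|zcq]; first by left.
      by right; rewrite (chord_uniq cG pp up zcq xz ap xa).
    by case=> /eqP ->.
  have nb : [set z in S | G b z] = [set x; c].
    apply/setP => z; rewrite !inE; apply/andP/orP => [[zS xz]|].
      have := noU z; rewrite /= zS xz /=.
      by case: eqP => [|_ /negbFE]; [left|right].
    case=> /eqP ->; first by rewrite adj_sym xS.
    by split=> //; apply: (allP cqS); rewrite mem_head.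
  split=> //.
  - rewrite !inE xS bS !andbT; split.
      by apply: contraNneq xbcq => ->; rewrite inE rcq orbT.
    by apply: contraNneq bcq => ->.
  - split=> //; apply: contraNneq xbcq => <-; by rewrite !inE eqxx orbT.
  - apply: reachable_setD => //.
      have rSD : r \in S :\: [set x; b] := allP (sub _ erefl) r rcq.
      by move: rSD; rewrite in_setD => /andP[].
    move=> w z wSD; rewrite !inE => zD wz.
    apply: (rooted_path_connect pcq (sub _ erefl)); first by rewrite -(eqP lp).
    move: wSD; rewrite !inE negb_or => /andP[/andP[wx wb] wS].
    case/orP: zD wz => /eqP ->; rewrite adj_sym => wz.
      have : w \in [set b; a] by rewrite -nx inE wS.
      by rewrite !inE (negPf wb) => /eqP ->; rewrite -in_cons.
    have : w \in [set x; c] by rewrite -nb inE wS.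
    by rewrite !inE (negPf wx) => /eqP ->; rewrite eqxx.
case/and4P=> uS bu ux uc.
have [uq|uq] := boolP (u \in q).
  by case: (stacked_chords_absurd cG pp up ap xa uq bu).
(* Replacing [x] by [u] yields a longest path again. *)
have ru : rooted_path S r u [:: b, c & q].
  case/andP: up => _ up; apply/and4P; split=> //.
  - by move: pp; rewrite /= (adj_sym G u) bu => /andP[_ ->].
  - apply/andP; split=> //; rewrite !inE (negPf uc) (negPf uq) !orbF.
    by apply: contraTneq bu => ->; rewrite adj_irrefl.
  - by move: Sp => /= /andP[_ ->]; rewrite uS.
case: (pickP [pred z | [&& z \in S, G u z & z != b]]) => [a'|]; last first.
  by move=> /noother h; left; exists u, b; apply: leafP.
case/and3P=> a'S ua' a'b.
have := endP _ _ ru erefl a' a'S ua'; rewrite inE (negPf a'b) /= => a'p.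
case/and4P: ru => pu uu _ _.
by have /eqP := fork_unique cG pp up ap xa pu uu a'p ua'; rewrite eq_sym (negPf ux).
Qed.

End Peeling.

(** * Moving the edges to a star and a matching *)

Section Energy.
Variables (R : realFieldType) (T : finType) (G : sgraph T).
Implicit Types (S : {set T}) (y : T -> R).

Definition energy S y := \sum_(u in S) \sum_(v in S | G u v) (y u + y v) ^+ 2.

(** The factor 2 is there because [energy] counts each edge in both
    directions. *)
Lemma energy_setD1 S u y : u \in S -> energy S y =
  energy (S :\ u) y + 2 * \sum_(v in S | G u v) (y u + y v) ^+ 2.
Proof.
move=> uS; rewrite /energy (big_setD1 u) //=.
have inner w : \sum_(v in S | G w v) (y w + y v) ^+ 2 =
    (if G u w then (y u + y w) ^+ 2 else 0) +
    \sum_(v in S :\ u | G w v) (y w + y v) ^+ 2.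
  rewrite big_mkcondr (big_setD1 u) //= adj_sym -big_mkcondr /=.
  by rewrite [y w + _]addrC.
rewrite (eq_bigr _ (fun w _ => inner w)) big_split /= [X in _ = _ + 2 * X]inner.
rewrite adj_irrefl add0r -big_mkcondr /=.
by rewrite inner adj_irrefl add0r; ring.
Qed.

(** The energy of the star at [r], plus that of the edges matched by [m], with
    [(y v + y (m v)) ^+ 2] replaced by the larger
    [2 * y v ^+ 2 + 2 * y (m v) ^+ 2] and the latter distributed over the two
    ends. *)
Definition star_energy S r m y :=
  \sum_(v in S :\ r) ((y v + y r) ^+ 2 + (if m v != v then 2 * y v ^+ 2 else 0)).

(** A matching is an involution whose fixed points are the unmatched vertices.
    The second neighbour [w] of a matched vertex serves the case of three
    vertices, where it has to be [r]. *)
Definition dominates S r m := [/\ involutive m, m r = r,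
  forall v, m v != v -> [/\ v \in S, G v (m v) & exists2 w, w != m v & G v w] &
  forall y, (forall v, 0 <= y v <= y r) -> energy S y <= 2 * star_energy S r m y].

Lemma sqrD_le (y : T -> R) r (yr : forall v, 0 <= y v <= y r) u v :
  (y u + y v) ^+ 2 <= (y u + y r) ^+ 2.
Proof.
have /andP[u0 _] := yr u; have /andP[v0 vr] := yr v.
by rewrite lerXn2r ?nnegrE ?addr_ge0 ?lerD2l //; apply: le_trans v0 vr.
Qed.

Lemma dominates_leaf S r u b m : leaf_at G S r u b ->
  dominates (S :\ u) r m -> dominates S r m.
Proof.
case; rewrite in_setD1 => /andP[ur uS] bS nu _ [mI mr mG mE].
split=> // [v mv|y yr].
  by have [vS vG vw] := mG v mv; split=> //; move: vS; rewrite in_setD1 => /andP[].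
have mu : m u = u.
  by apply/eqP/negPn/negP => /mG[+ _ _]; rewrite in_setD1 eqxx.
rewrite (energy_setD1 y uS) -big_set /= nu big_set1 /star_energy.
rewrite (big_setD1 u) ?in_setD1 ?ur //= mu eqxx addr0 mulrDr addrC.
apply: lerD; first by rewrite ler_pM2l ?ltr0n //; apply: sqrD_le.
by rewrite setDDl setUC -setDDl; apply: mE.
Qed.

(** The edges [{v, a}] and [{b, c}] move to [{v, r}] and [{b, r}], and the edge
    [{v, b}] becomes a matched one. *)
Lemma dominates_ear S r v b a c m : ear_at G S r v b a c ->
  dominates (S :\: [set v; b]) r m -> exists m', dominates S r m'.
Proof.
case=> [[]]; rewrite !in_setD1 => /andP[vr vS] /andP[br bS] [ab cv] nv nb _.
case=> [mI mr mG mE].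
have vb : G v b.
  by have : b \in [set b; a] by [rewrite !inE eqxx]; rewrite -nv inE => /andP[].
have va : G v a.
  by have : a \in [set b; a] by [rewrite !inE eqxx orbT]; rewrite -nv inE => /andP[].
have bc : G b c.
  by have : c \in [set v; c] by [rewrite !inE eqxx orbT]; rewrite -nb inE => /andP[].
have bv : (b == v) = false by apply: contraTF vb => /eqP ->; rewrite adj_irrefl.
have cb : (c == b) = false by apply: contraTF bc => /eqP ->; rewrite adj_irrefl.
have mfix x : x \in [set v; b] -> m x = x.
  by move=> xvb; apply/eqP; apply: contraTT xvb => /mG[+ _ _]; rewrite in_setD => /andP[].
have mv : m v = v by apply: mfix; rewrite !inE eqxx.
have mb : m b = b by apply: mfix; rewrite !inE eqxx orbT.
pose m' x := if x == v then b else if x == b then v else m x.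
have m'v : m' v = b by rewrite /m' eqxx.
have m'b : m' b = v by rewrite /m' bv eqxx.
have m'E x : x != v -> x != b -> m' x = m x.
  by rewrite /m' => /negPf -> /negPf ->.
exists m'; split.
- move=> x; have [->|xv] := eqVneq x v; first by rewrite m'v m'b.
  have [->|xb] := eqVneq x b; first by rewrite m'b m'v.
  rewrite (m'E x) // m'E ?mI //; first by apply: contraNneq xv => e; rewrite -[x]mI e mv.
  by apply: contraNneq xb => e; rewrite -[x]mI e mb.
- by rewrite m'E // eq_sym.
- move=> x; have [->|xv] := eqVneq x v; first by rewrite m'v; split=> //; exists a.
  have [->|xb] := eqVneq x b.
    by rewrite m'b; split=> //; [rewrite adj_sym|exists c].
  rewrite m'E // => /mG [xS]; split=> //.
  by move: xS; rewrite in_setD => /andP[].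
move=> y yr.
rewrite (energy_setD1 y vS) -[\sum_(_ in S | _) _]big_set /= nv.
have bSv : b \in S :\ v by rewrite in_setD1 bv.
rewrite (energy_setD1 y bSv) -[\sum_(_ in S :\ v | _) _]big_set /=.
have -> : [set z in S :\ v | G b z] = [set c].
  have -> : [set z in S :\ v | G b z] = [set v; c] :\ v.
    by rewrite -nb; apply/setP => z; rewrite !inE andbA.
  by apply/setP => z; rewrite !inE; case: eqP => //= ->; rewrite eq_sym (negPf cv).
rewrite big_set1 big_setU1 ?inE 1?eq_sym //= big_set1 /star_energy.
rewrite (big_setD1 v) ?in_setD1 ?vr //= m'v bv /=.
rewrite (big_setD1 b) ?in_setD1 ?br ?bv //= m'b [v == b]eq_sym bv /=.
have eS : star_energy (S :\: [set v; b]) r m' y = star_energy (S :\: [set v; b]) r m y.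
  apply: eq_bigr => x; rewrite !inE negb_or => /and3P[_ /andP[xv xb] _].
  by rewrite m'E.
have := mE y yr; rewrite -eS /star_energy -!(setDDl S).
have -> : S :\ r :\ v :\ b = S :\ v :\ b :\ r.
  by apply/setP => z; rewrite !inE; case: (z == r); case: (z == v); case: (z == b).
have := sqrD_le yr v a; have := sqrD_le yr b c.
have : (y v + y b) ^+ 2 <= 2 * y v ^+ 2 + 2 * y b ^+ 2.
  by rewrite -subr_ge0 [leRHS](_ : _ = (y v - y b) ^+ 2) ?sqr_ge0 //; ring.
set E := energy _ _; set F := \sum_(_ in _) _.
move: ((y v + y b) ^+ 2) ((y v + y r) ^+ 2) ((y v + y a) ^+ 2) => p1 p2 p3.
move: ((y b + y c) ^+ 2) ((y b + y r) ^+ 2) => p4 p5.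
lra.
Qed.

Lemma cactus_dominates_in r S : cactus G -> r \in S -> reachable_in G S r ->
  exists m, dominates S r m.
Proof.
move=> cG; have [k] := ubnP #|S|; elim: k S => // k IH S /ltnSE Sk rS reachS.
have [S1|S1] := ltnP 1 #|S|; last first.
  have SE : S = [set r].
    by apply/esym/eqP; rewrite eqEcard sub1set rS cards1.
  exists id; split=> // [v|y _]; first by rewrite eqxx.
  rewrite SE /star_energy setDv big_set0 mulr0 /energy big_set1 big_pred0 //.
  by move=> v; rewrite inE; case: eqP => //= ->; rewrite adj_irrefl.
have [[u [b leaf]]|[v [b [a [c ear]]]]] := leaf_or_ear cG rS S1 reachS.
  have [/setD1P[ur uS] _ _ reachSu] := leaf.
  have [||//|m mD] := IH (S :\ u); last by exists m; apply: dominates_leaf leaf mD.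
    by move: Sk; rewrite (cardsD1 u S) uS.
  by rewrite in_setD1 eq_sym ur.
have [[/setD1P[vr vS] /setD1P[br bS]] _ _ _ reachSvb] := ear.
have [||//|m mD] := IH (S :\: [set v; b]); last exact: dominates_ear ear mD.
  apply: leq_trans Sk; apply: proper_card; apply/properP; split; first exact: subsetDl.
  by exists v => //; rewrite !inE eqxx.
by rewrite !inE negb_or ![r == _]eq_sym vr br.
Qed.

Lemma cactus_dominates r : cactus G -> exists m, dominates setT r m.
Proof.
move=> cG; apply: cactus_dominates_in => // u _.
have [/(_ r u) ru _] := cG; apply: connect_sub ru => x y xy.
by apply: connect1; apply/and3P; rewrite !inE.
Qed.

End Energy.

(** * Cacti with a vertex adjacent to all the others *)

Section Iso.
Variables (n : nat) (G : sgraph 'I_n).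
Implicit Types (r u v w : 'I_n) (m : 'I_n -> 'I_n).

(** Each orbit of size two contains exactly one [v] with [v < m v]. *)
Lemma card_moved m : involutive m ->
  #|[set v | m v != v]| = (#|[set v : 'I_n | (v < m v)%N]|).*2.
Proof.
move=> mI; pose A := [set v : 'I_n | (v < m v)%N].
have mA : m @: A = [set v : 'I_n | (m v < v)%N].
  apply/setP => v; rewrite inE; apply/imsetP/idP => [[u]|mv].
    by rewrite inE => um ->; rewrite mI.
  by exists (m v); rewrite ?inE mI.
have -> : [set v | m v != v] = A :|: m @: A.
  by apply/setP => v; rewrite mA !inE -val_eqE /= neq_ltn orbC.
rewrite cardsU (card_imset _ (inv_inj mI)) -[RHS]addnn.
rewrite [A :&: _](_ : _ = set0) ?cards0 ?subn0 //.
by apply/setP => v; rewrite mA !inE; case: ltngtP.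
Qed.

(** Around a vertex adjacent to all the others the cactus has no room for two
    edges at [v]: they would close two triangles on the edge from [r] to [v]. *)
Lemma cactus_hub_uniq r v w u : cactus G -> (forall z, z != r -> G r z) ->
  v != r -> w != r -> u != r -> G v w -> G v u -> w = u.
Proof.
move=> cG hub vr wr ur vw vu.
have tri z : z != r -> G v z -> is_cycle G [:: r; v; z].
  move=> zr vz; rewrite /is_cycle /ucycleb /= !inE !negb_or !andbT.
  rewrite hub // vz adj_sym hub //= ![r == _]eq_sym vr zr /=.
  by apply: contraTneq vz => ->; rewrite adj_irrefl.
have /(_ w) : [:: r; v; w] =i [:: r; v; u].
  apply: (cactus_same_cycle cG (tri w wr vw) (tri u ur vu) vr);
    by rewrite !inE eqxx ?orbT.
rewrite !inE eqxx !orbT (negPf wr) /= => /esym /orP[/eqP wv|/eqP //].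
by rewrite wv adj_irrefl in vw.
Qed.

(** A matched vertex has its matched edge and, by the previous lemma, no other
    one away from [r]. Two unmatched vertices cannot be adjacent because there
    is at most one. *)
Lemma hub_adjE r m k : cactus G -> (forall z, z != r -> G r z) ->
  involutive m -> m r = r -> (forall v, m v != v -> G v (m v)) ->
  #|[set v | m v == v] :\ r| = k -> (k <= 1)%N ->
  forall v w, v != r -> w != r -> G v w = (m v != v) && (w == m v).
Proof.
move=> cG hub mI mr mG cU k1 v w vr wr.
have mNr z : z != r -> m z != r by apply: contraNneq => e; rewrite -[z]mI e mr.
apply/idP/andP => [vw|[mv /eqP ->]]; last exact: mG.
have vNw : v != w by apply: contraTneq vw => ->; rewrite adj_irrefl.
have [mv|mv] := eqVneq (m v) v; last first.
  by split=> //; apply/eqP/(cactus_hub_uniq cG hub vr _ _ vw (mG v mv)); auto.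
have [mw|mw] := eqVneq (m w) w; last first.
  have vmw : v = m w.
    apply: (cactus_hub_uniq cG hub wr _ _ _ (mG w mw)); rewrite ?mNr //.
    by rewrite adj_sym.
  by move: vNw; rewrite -mv vmw mI eqxx.
move: k1; rewrite -cU leqNgt => /negP[]; apply/card_gt1P; exists v, w.
by rewrite !inE vr wr mv mw !eqxx.
Qed.

(** The isomorphism is built from the side of the model graph: the two vertices
    of the [i]-th triangle are sent to the [i]-th vertex [v] with [v < m v] and
    to [m v]. *)
Lemma hub_iso r m s k : cactus G -> (forall z, z != r -> G r z) ->
  involutive m -> m r = r -> (forall v, m v != v -> G v (m v)) ->
  #|[set v | m v == v] :\ r| = k -> (k <= 1)%N -> n = (s.*2 + k).+1 ->
  graph_iso G (Hgraph s k).
Proof.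
move=> cG hub mI mr mG cU k1 nE.
have adjE := hub_adjE cG hub mI mr mG cU k1.
have cA : s = #|[set v : 'I_n | (v < m v)%N]|.
  have := cardsC [set v | m v == v]; rewrite card_ord (cardsD1 r) inE mr eqxx cU.
  rewrite (_ : ~: _ = [set v | m v != v]) ?card_moved //; first by lia.
  by apply/setP => v; rewrite !inE.
pose a (i : 'I_s) := enum_val (cast_ord cA i).
pose b (j : 'I_k) := enum_val (cast_ord (esym cU) j).
have a_inj : injective a by move=> i j /enum_val_inj /cast_ord_inj.
have b_inj : injective b by move=> i j /enum_val_inj /cast_ord_inj.
have a_lt i : (a i < m (a i))%N by have := enum_valP (cast_ord cA i); rewrite inE.
have ma i : m (a i) != a i by rewrite -val_eqE /= neq_ltn a_lt orbT.
have ar i : a i != r by apply: contraNneq (ma i) => ->; rewrite mr.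
have mar i : m (a i) != r by apply: contraNneq (ar i) => e; rewrite -[a i]mI e mr.
have mb j : m (b j) = b j /\ b j != r.
  by have := enum_valP (cast_ord (esym cU) j); rewrite !inE => /andP[? /eqP].
have aNma i j : (a i == m (a j)) = false.
  by apply/eqP => aij; have := a_lt i; rewrite aij mI ltnNge ltnW.
have maNa i j : (m (a i) == a j) = false by rewrite eq_sym.
have eqa i j : (a i == a j) = (i == j) by apply: inj_eq.
have eqma i j : (m (a i) == m (a j)) = (i == j) by rewrite (inj_eq (inv_inj mI)).
pose g (h : H_vertex s k) := match h with
  | None => r
  | Some (inl (i, c)) => if c then m (a i) else a i
  | Some (inr j) => b j end.
have bNa j i c : b j = (if c then m (a i) else a i) -> False.
  have [mbj _] := mb j => e; move: mbj; rewrite e.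
  by case: c {e}; rewrite ?mI => /eqP; rewrite ?aNma ?maNa.
have g_adj h h' : G (g h) (g h') = Hgraph s k h h'.
  have gr x : g (Some x) != r by case: x => [[i []]|j] //=; case: (mb j).
  case: h h' => [x|] [y|]; last exact: adj_irrefl; last by rewrite hub.
  - rewrite adjE //; case: x y => [[i c]|j] [[i' c']|j'] /=.
    + case: c; case: c'; rewrite !(mI, aNma, maNa, eqa, eqma) ?andbF //=;
        by rewrite eq_sym andbT.
    + apply/andP => -[_ /eqP e]; apply: (bNa j' i (~~ c)); rewrite e.
      by case: c {e}; rewrite ?mI.
    + by have [-> _] := mb j; rewrite eqxx.
    + by have [-> _] := mb j; rewrite eqxx.
  by rewrite adj_sym hub //; case: x => [[]|].
have g_inj : injective g.
  move=> [[[i c]|j]|] [[[i' c']|j']|] //=.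
  - case: c; case: c' => /eqP; rewrite ?(eqma, eqa, aNma, maNa) //; by move/eqP ->.
  - by move/esym/bNa.
  - by case: c => /eqP; rewrite ?(negPf (ar i)) ?(negPf (mar i)).
  - by move/bNa.
  - by move/b_inj ->.
  - by case: (mb j) => _ /negPf h /eqP; rewrite h.
  - by case: c' => /eqP; rewrite eq_sym ?(negPf (ar i')) ?(negPf (mar i')).
  - by case: (mb j') => _ /negPf h /eqP; rewrite eq_sym h.
have [f gK fK] : bijective g.
  apply: inj_card_bij g_inj _.
  by rewrite card_ord card_option card_sum card_prod !card_ord card_bool nE muln2.
exists f; split; first by exists g.
by move=> x y; rewrite -g_adj !fK.
Qed.

End Iso.

(** * The quadratic form of a star with a matching *)

Section Gap.
Variables (R : realFieldType) (n : nat) (G : sgraph 'I_n).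
Implicit Types (m : 'I_n -> 'I_n) (y : 'I_n -> R) (r : 'I_n) (lam : R).

Definition gap_weight lam m v : R := lam - (if m v != v then 3 else 1).

(** The eigenvalue equation at the centre of the graph with [s] triangles and
    [k] pendant vertices, for the vector with value 1 at the centre: the
    equations at the other vertices force the values [(lam - 3)^-1] on the
    triangles and [(lam - 1)^-1] on the pendant vertices. *)
Definition H_value_eq lam s k : Prop :=
  lam = s.*2%:R * (1 + (lam - 3)^-1) + k%:R * (1 + (lam - 1)^-1).

(** The left side is a quadratic form in which each [y v] with [v != r] is
    coupled with [y r] only, so one completes the square for each of them. *)
Lemma star_energy_gap lam m r y : 3 < lam ->
  lam * (\sum_v y v ^+ 2) - star_energy setT r m y =
  \sum_(v in setT :\ r)
     gap_weight lam m v * (y v - y r / gap_weight lam m v) ^+ 2 +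
  (lam - \sum_(v in setT :\ r) (1 + (gap_weight lam m v)^-1)) * y r ^+ 2.
Proof.
move=> lam3; have -> : \sum_v y v ^+ 2 = y r ^+ 2 + \sum_(v in setT :\ r) y v ^+ 2.
  by rewrite -(big_setD1 r) //; apply: eq_bigl => v; rewrite inE.
rewrite mulrDr -addrA [_ - star_energy _ _ _ _](_ : _ =
  \sum_(v in setT :\ r)
     gap_weight lam m v * (y v - y r / gap_weight lam m v) ^+ 2 -
  (\sum_(v in setT :\ r) (1 + (gap_weight lam m v)^-1)) * y r ^+ 2); first by ring.
rewrite mulr_sumr mulr_suml -!sumrB; apply: eq_bigr => v _.
by rewrite /gap_weight; case: (m v != v); field; lra.
Qed.

(** The matched vertices are even in number, so that the number of unmatched
    ones, apart from [r], exceeds [k] by an even number [j.*2]; each of them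
    replaces a term [(lam - 3)^-1] of [H_value_eq] by the smaller
    [(lam - 1)^-1]. *)
Lemma sum_gap_weight lam m r s k : involutive m -> m r = r -> 3 < lam ->
  (k <= 1)%N -> n = (s.*2 + k).+1 -> H_value_eq lam s k ->
  exists j, #|[set v | m v == v] :\ r| = (k + j.*2)%N /\
  lam - \sum_(v in setT :\ r) (1 + (gap_weight lam m v)^-1) =
    j.*2%:R * ((lam - 3)^-1 - (lam - 1)^-1).
Proof.
move=> mI mr lam3 k1 nE lamE.
have cM := card_moved mI; set a := #|[set v : 'I_n | _]| in cM.
set U := _ :\ r.
have cU : (a.*2 + #|U|)%N = (s.*2 + k)%N.
  have := cardsC [set v | m v == v]; rewrite card_ord (cardsD1 r) inE mr eqxx.
  rewrite (_ : ~: _ = [set v | m v != v]) ?cM -/U; first by lia.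
  by apply/setP => v; rewrite !inE.
exists (s - a)%N; split; first by lia.
have -> : \sum_(v in setT :\ r) (1 + (gap_weight lam m v)^-1) =
    a.*2%:R * (1 + (lam - 3)^-1) + #|U|%:R * (1 + (lam - 1)^-1).
  rewrite (bigID (fun v => m v != v)) /=; congr (_ + _).
    rewrite (eq_bigr (fun=> 1 + (lam - 3)^-1)); last first.
      by move=> v /andP[_ mv]; rewrite /gap_weight mv.
    rewrite (eq_bigl (mem [set v | m v != v])); last first.
      move=> v; rewrite !inE andbT; case: eqP => [->|] //=.
      by rewrite mr eqxx.
    by rewrite sumr_const cM mulr_natl.
  rewrite (eq_bigr (fun=> 1 + (lam - 1)^-1)); last first.
    by move=> v /andP[_ mv]; rewrite /gap_weight (negPf mv).
  rewrite (eq_bigl (mem U)); last by move=> v; rewrite !inE negbK andbT.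
  by rewrite sumr_const mulr_natl.
have -> : #|U| = (k + (s - a).*2)%N by lia.
rewrite {1}lamE; have -> : s.*2 = (a.*2 + (s - a).*2)%N by lia.
by rewrite !natrD; ring.
Qed.

(** After [y r] is lowered to [t], the domination by the star still holds, since
    [y r] remains the maximum. The edges at [r] lose the same amount on both
    sides, but the star loses in addition a positive amount for each vertex not
    adjacent to [r]; starting from equality there can be no such vertex. *)
Lemma tight_adjacent r m y t : dominates R G setT r m ->
  (forall v, 0 <= y v) -> 0 <= t < y r -> (forall v, v != r -> y v <= t) ->
  2 * star_energy setT r m y <= energy G setT y -> forall v, v != r -> G r v.
Proof.
case=> _ _ _ mE y0 /andP[t0 tr] yt tight.
pose y' v := if v == r then t else y v.
have y'r : y' r = t by rewrite /y' eqxx.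
have y'E v : v != r -> y' v = y v by rewrite /y' => /negPf ->.
have E' : energy G setT y' <= 2 * star_energy setT r m y'.
  apply: mE => v; rewrite y'r; have [->|vr] := eqVneq v r; first by rewrite y'r t0 lexx.
  by rewrite y'E // y0 yt.
pose d v := (y v + y r) ^+ 2 - (y v + t) ^+ 2.
have d0 v : 0 < d v.
  have := y0 v; rewrite /d => ?.
  by rewrite subr_gt0 ltrXn2r ?nnegrE ?ltrD2l // addr_ge0 //; lra.
have dstar : star_energy setT r m y = star_energy setT r m y' + \sum_(v in setT :\ r) d v.
  rewrite /star_energy -big_split; apply: eq_bigr => v; rewrite !inE andbT => vr.
  by rewrite y'r y'E // /d /=; ring.
have denergy : energy G setT y = energy G setT y' + 2 * \sum_(v in setT | G r v) d v.
  rewrite (energy_setD1 _ y (in_setT r)) (energy_setD1 _ y' (in_setT r)).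
  rewrite -addrA -mulrDr -big_split /=; congr (_ + 2 * _).
    apply: eq_bigr => u /setD1P[ur _]; apply: eq_bigr => v /andP[/setD1P[vr _] _].
    by rewrite !y'E.
  apply: eq_bigr => v /andP[_ rv]; rewrite y'r y'E /d; first by ring.
  by apply: contraTneq rv => ->; rewrite adj_irrefl.
have : \sum_(v in setT :\ r) d v <= \sum_(v in setT | G r v) d v.
  by rewrite -(ler_pM2l (ltr0n R 2)); lra.
rewrite (bigID (G r)) /= (eq_bigl (fun v => (v \in setT) && G r v)); last first.
  move=> v; rewrite !inE andbT; case: eqP => //= ->; by rewrite adj_irrefl.
rewrite gerDl => le0 v vr; apply: contraTT le0 => rv; rewrite -ltNge.
rewrite (bigD1 v) /=; last by rewrite !inE vr.
by apply: ltr_wpDr => //; apply: sumr_ge0 => u _; apply: ltW.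
Qed.

(** For [lam <= 4] the right side of [H_value_eq] is at least
    [s.*2%:R * 2 + k%:R >= 5]. On three vertices [lam] is equal to 4. *)
Lemma H_value_gt4 lam s k : 3 < lam -> (0 < s)%N -> (2 < s.*2 + k)%N ->
  H_value_eq lam s k -> 4 < lam.
Proof.
move=> lam3 s0 sk lamE; rewrite ltNge; apply/negP => lam4.
have h3 : 1 <= (lam - 3)^-1 by rewrite invf_ge1; lra.
have h1 : 0 <= (lam - 1)^-1 by rewrite invr_ge0; lra.
have : s.*2%:R * 2 + k%:R <= lam.
  rewrite lamE; apply: lerD; first by apply: ler_wpM2l => //; lra.
  by apply: ler_peMr => //; lra.
have : 5 <= s.*2%:R * 2 + k%:R :> R.
  by rewrite -natrM -natrD ler_nat; lia.
by lra.
Qed.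

Section Bound.
Variables (lam : R) (s k : nat).
Hypotheses (cG : cactus G) (lam3 : 3 < lam) (k1 : (k <= 1)%N).
Hypotheses (nE : n = (s.*2 + k).+1) (lamE : H_value_eq lam s k).

Lemma inv_gap_gt0 : 0 < (lam - 3)^-1 - (lam - 1)^-1.
Proof. by have l3 := lam3; rewrite subr_gt0 ltf_pV2 ?posrE; lra. Qed.

Lemma gap_weight_gt0 m v : 0 < gap_weight lam m v.
Proof. by have l3 := lam3; rewrite /gap_weight; case: ifP => _; lra. Qed.

Lemma exists_argmax y : exists r, forall v, y v <= y r.
Proof.
have i0 : 'I_n by rewrite nE; exact: ord0.
by have [r _ rmax] := @arg_maxP _ _ _ i0 xpredT y isT; exists r => v; apply: rmax.
Qed.

Lemma star_energy_le m r y : involutive m -> m r = r ->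
  star_energy setT r m y <= lam * \sum_v y v ^+ 2.
Proof.
move=> mI mr; rewrite -subr_ge0 (star_energy_gap m r y lam3).
have [j [_ ->]] := sum_gap_weight mI mr lam3 k1 nE lamE.
apply: addr_ge0; last by rewrite mulr_ge0 ?sqr_ge0 // mulr_ge0 // ltW ?inv_gap_gt0.
by apply: sumr_ge0 => v _; rewrite mulr_ge0 ?sqr_ge0 // ltW ?gap_weight_gt0.
Qed.

Lemma energy_le y : (forall v, 0 <= y v) ->
  energy G setT y <= 2 * (lam * \sum_v y v ^+ 2).
Proof.
move=> y0; have [r rmax] := exists_argmax y.
have [m [mI mr _ mE]] := cactus_dominates R r cG.
apply: le_trans (mE y _) _; first by move=> v; rewrite y0 rmax.
by rewrite ler_pM2l ?ltr0n //; apply: star_energy_le.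
Qed.

(** In the case of equality both terms of [star_energy_gap] vanish: this fixes
    the number of unmatched vertices and the values of [y]. *)
Lemma energy_eq_iso y : (0 < s)%N -> (forall v, 0 <= y v) -> (exists v, y v != 0) ->
  energy G setT y = 2 * (lam * \sum_v y v ^+ 2) -> graph_iso G (Hgraph s k).
Proof.
move=> s0 y0 [v0 yv0] tight; have [r rmax] := exists_argmax y.
have yr0 : 0 < y r.
  by apply: lt_le_trans (rmax v0); rewrite lt_def yv0 y0.
have [m mD] := cactus_dominates R r cG; have [mI mr mG mE] := mD.
have := mE y (fun v => introT andP (conj (y0 v) (rmax v))).
rewrite tight ler_pM2l ?ltr0n // -subr_le0 (star_energy_gap m r y lam3).
have [j [cU ->]] := sum_gap_weight mI mr lam3 k1 nE lamE.
set A := \sum_(v in _) _; set B := _ * y r ^+ 2 => AB0.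
have A_ge0 v : 0 <= gap_weight lam m v * (y v - y r / gap_weight lam m v) ^+ 2.
  by rewrite mulr_ge0 ?sqr_ge0 // ltW ?gap_weight_gt0.
have A0 : 0 <= A by apply: sumr_ge0.
have B0 : 0 <= B by rewrite mulr_ge0 ?sqr_ge0 // mulr_ge0 // ltW ?inv_gap_gt0.
have {cU} cU : #|[set v | m v == v] :\ r| = k.
  have /eqP : B = 0 by lra.
  rewrite /B mulf_eq0 mulf_eq0 sqrf_eq0 (gt_eqF inv_gap_gt0) (gt_eqF yr0) !orbF.
  rewrite pnatr_eq0 double_eq0 => /eqP j0.
  by rewrite cU j0 addn0.
have yE v : v != r -> y v = y r / gap_weight lam m v.
  move=> vr; have /eqP : A = 0 by lra.
  rewrite psumr_eq0 => [/allP/(_ v (mem_index_enum v))|u _]; last exact: A_ge0.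
  rewrite !inE vr /= mulf_eq0 gt_eqF ?gap_weight_gt0 //= sqrf_eq0 subr_eq0.
  by move/eqP.
apply: (hub_iso cG _ mI mr (fun v mv => let: And3 _ vm _ := mG v mv in vm) cU k1 nE).
have [sk|sk] := ltnP 2 (s.*2 + k)%N.
  have lam4 := H_value_gt4 lam3 s0 sk lamE.
  apply: (@tight_adjacent _ m y (y r / (lam - 3)) mD y0).
  - rewrite divr_ge0 ?subr_ge0 ?ltW //= ltr_pdivrMr ?subr_gt0 //.
    by rewrite ltr_pMr //; lra.
  - move=> v vr; rewrite yE //; rewrite ler_pM2l // lef_pV2 ?posrE ?gap_weight_gt0 //.
      by rewrite /gap_weight; case: ifP => _; lra.
    by rewrite subr_gt0.
  by rewrite tight ler_pM2l ?ltr0n //; apply: star_energy_le.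
(* On three vertices [lam = 4] and [y] is constant, so that [y r] cannot be
   lowered; but both vertices other than [r] are matched, and their second
   neighbour has to be [r]. *)
move=> v vr.
have mv : m v != v.
  apply/negP => /eqP mv.
  have : v \in [set v | m v == v] :\ r by rewrite !inE vr mv eqxx.
  by apply/negP; move: cU; rewrite (_ : k = 0%N) => [/cards0_eq ->|]; [rewrite inE | lia].
have [_ vmv [w wm vw]] := mG v mv.
suff -> : r = w by rewrite adj_sym.
have mvr : m v != r by apply: contraNneq vr => e; rewrite -[v]mI e mr.
have wv : w != v by apply: contraTneq vw => ->; rewrite adj_irrefl.
apply: val_inj => /=; move: vr mv wm mvr wv; rewrite -!val_eqE /=.
move: (ltn_ord v) (ltn_ord r) (ltn_ord w) (ltn_ord (m v)); rewrite [X in (_ < X)%N]nE.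
by move: (val v) (val r) (val w) (val (m v)) => /= *; lia.
Qed.

End Bound.
End Gap.

(** * The spectral radius *)

Lemma sum_option (V : nmodType) (T : finType) (F : option T -> V) :
  \sum_h F h = F None + \sum_t F (Some t).
Proof.
rewrite (bigD1 None) //=; congr (_ + _).
rewrite (reindex_omap Some id) /=; last by case.
by apply: eq_bigl => t; rewrite eqxx.
Qed.

Section Spectrum.
Variables (R : realType) (n : nat) (G : sgraph 'I_n).
Implicit Types (x : 'rV[R]_n) (q : R).

Lemma mul_signless_laplacianE x j :
  (x *m signless_laplacian R G) 0 j = \sum_(i | G j i) (x 0 i + x 0 j).
Proof.
rewrite /signless_laplacian mulmxDr mul_mx_diag !mxE addrC big_split /=.
congr (_ + _).
  rewrite [RHS]big_mkcond; apply: eq_bigr => i _; rewrite mxE adj_sym.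
  by case: (G j i); rewrite ?mulr1 ?mulr0.
by rewrite sumr_const /degree cardsE mulr_natr.
Qed.

(** Multiply the eigenvalue equation at [j] by [x 0 j] and sum over [j]. *)
Lemma eigenvector_energy x q : x *m signless_laplacian R G = q *: x ->
  energy G setT (x 0) = 2 * (q * \sum_v x 0 v ^+ 2).
Proof.
move=> xQ.
have <- : \sum_j (\sum_(i | G j i) (x 0 i + x 0 j)) * x 0 j = q * \sum_v x 0 v ^+ 2.
  rewrite mulr_sumr; apply: eq_bigr => j _.
  by rewrite -mul_signless_laplacianE xQ mxE expr2 mulrA.
have E1 : \sum_j (\sum_(i | G j i) (x 0 i + x 0 j)) * x 0 j =
    \sum_j \sum_(i | G j i) (x 0 j + x 0 i) * x 0 j.
  by apply: eq_bigr => j _; rewrite mulr_suml; under eq_bigr do rewrite addrC.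
have E2 : \sum_j \sum_(i | G j i) (x 0 j + x 0 i) * x 0 j =
    \sum_j \sum_(i | G j i) (x 0 j + x 0 i) * x 0 i.
  rewrite (exchange_big_dep xpredT) //=; apply: eq_bigr => i _.
  by apply: eq_big => j; [rewrite adj_sym | rewrite addrC].
rewrite E1 mulr_natl mulr2n [X in _ = _ + X]E2 -big_split /energy.
apply: eq_big => [u|u _]; first by rewrite inE.
rewrite -big_split; apply: eq_big => [v|v _]; first by rewrite inE.
by rewrite /=; ring.
Qed.

Lemma energy_norm (y : 'I_n -> R) :
  energy G setT y <= energy G setT (fun v => `|y v|).
Proof.
apply: ler_sum => u _; apply: ler_sum => v _.
by rewrite -real_normK ?num_real // lerXn2r ?nnegrE ?addr_ge0 // ler_normD.
Qed.

Section Value.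
Variables (lam : R) (s k : nat).
Hypotheses (lam3 : 3 < lam) (lamE : H_value_eq lam s k).

Definition H_eigenvector (h : H_vertex s k) : R := match h with
  | None => 1 | Some (inl _) => (lam - 3)^-1 | Some (inr _) => (lam - 1)^-1 end.

Lemma H_eigenvectorE h0 :
  \sum_(h | Hgraph s k h0 h) (H_eigenvector h + H_eigenvector h0) =
  lam * H_eigenvector h0.
Proof.
have l3 := lam3; rewrite big_mkcond sum_option big_sumType /=.
have pairE (F : 'I_s * bool -> R) :
    \sum_p F p = \sum_i (F (i, true) + F (i, false)).
  rewrite (eq_bigr (fun p => F (p.1, p.2))); last by case.
  rewrite -(pair_bigA _ (fun i c => F (i, c))) /=.
  by apply: eq_bigr => i _; rewrite big_bool.
rewrite pairE.
case: h0 => [[[i c]|j]|] /=.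
- rewrite (bigD1 i) //= eqxx big1 => [|i' /negPf ii']; last first.
    by rewrite eq_sym ii' addr0.
  rewrite big1_eq !addr0; case: c; rewrite /= ?addr0 ?add0r; field; lra.
- rewrite !big1 => [|? _|? _]; rewrite ?addr0 //; field; lra.
rewrite !sumr_const !card_ord add0r mulr1 [RHS]lamE.
by rewrite -[_ *+ s]mulr_natl -[_ *+ k]mulr_natl -muln2 natrM; ring.
Qed.

Lemma iso_eigenvalue : graph_iso G (Hgraph s k) ->
  eigenvalue (signless_laplacian R G) lam.
Proof.
case=> f [[g fK gK] fG]; apply/eigenvalueP.
exists (\row_i H_eigenvector (f i)); last first.
  apply/eqP => /rowP /(_ (g None)); rewrite !mxE gK /=.
  by apply/eqP; rewrite oner_eq0.
apply/rowP => j; rewrite mul_signless_laplacianE !mxE -H_eigenvectorE.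
rewrite [RHS](reindex f); last by exists g => ? _; [rewrite fK|rewrite gK].
by apply: eq_big => [i|i _]; [rewrite fG|rewrite !mxE].
Qed.

(** The bound is proved for the absolute values of an eigenvector, which saves
    an appeal to the Perron-Frobenius theorem. *)
Lemma cactus_radius_le (k1 : (k <= 1)%N) (s0 : (0 < s)%N)
    (nE : n = (s.*2 + k).+1) : cactus G ->
  signless_radius R G <= lam /\
  (signless_radius R G = lam <-> graph_iso G (Hgraph s k)).
Proof.
move=> cG; have n0 : (0 < n)%N by rewrite nE.
have [qe qmax] := signless_radiusP R G n0.
set q := signless_radius R G in qe qmax *.
have [x xQ x0] := eigenvalueP qe.
have {xQ} xE := eigenvector_energy xQ.
have [v xv0] : exists v, x 0 v != 0 by apply/rV0Pn.
pose y v := `|x 0 v|; have y0 w : 0 <= y w by apply: normr_ge0.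
have yE : \sum_v y v ^+ 2 = \sum_v x 0 v ^+ 2.
  by apply: eq_bigr => w _; rewrite real_normK ?num_real.
have x2_gt0 : 0 < \sum_v x 0 v ^+ 2.
  rewrite (bigD1 v) //= ltr_pwDl ?exprn_even_gt0 //.
  by apply: sumr_ge0 => w _; apply: sqr_ge0.
have xy := energy_norm (x 0).
have yle := energy_le cG lam3 k1 nE lamE y0.
split.
  move: (le_trans xy yle); rewrite yE xE.
  by rewrite ler_pM2l ?ltr0n // ler_pM2r.
split=> [qlam|/iso_eigenvalue/qmax lamq].
  apply: (energy_eq_iso cG lam3 k1 nE lamE s0 y0).
    by exists v; rewrite normr_eq0.
  by apply/le_anti; rewrite yle yE -qlam -xE.
apply/le_anti; rewrite lamq andbT.
move: (le_trans xy yle); rewrite yE xE.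
by rewrite ler_pM2l ?ltr0n // ler_pM2r.
Qed.

End Value.
End Spectrum.

Lemma sqrt_ge_sqr (R : rcfType) (a b : R) : 0 <= a -> a ^+ 2 <= b -> a <= Num.sqrt b.
Proof. by move=> a0 ab; rewrite -[a]ger0_norm // -sqrtr_sqr ler_wsqrtr. Qed.

Theorem theorem3p2 (R : realType) (n : nat) (G : sgraph 'I_n)
    (n_ge3 : (3 <= n)%N) (cactusG : cactus G) :
  (odd n ->
     let bound : R := ((n%:R + 2) + Num.sqrt (n%:R ^+ 2 - 4 * n%:R + 12)) / 2 in
     signless_radius R G <= bound /\
     (signless_radius R G = bound <-> graph_iso G (Hgraph ((n - 1)./2)%N 0)))
  /\
  (~~ odd n ->
     let bound : R := ((n%:R + 1) + Num.sqrt (n%:R ^+ 2 - 2 * n%:R + 9)) / 2 in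
     signless_radius R G <= bound /\
     (signless_radius R G = bound <-> graph_iso G (Hgraph (n./2 - 1)%N 1))).
Proof.
have n3 : 3 <= n%:R :> R by rewrite ler_nat.
split=> n_odd bound.
  set s := (n - 1)./2; have nE : n = s.*2.+1 by lia.
  pose d := Num.sqrt (n%:R ^+ 2 - 4 * n%:R + 12 : R).
  have d2 : d ^+ 2 = n%:R ^+ 2 - 4 * n%:R + 12 by rewrite sqr_sqrtr //; nra.
  have d3 : 3 <= d by apply: sqrt_ge_sqr => //; nra.
  have bE : bound = (n%:R + 2 + d) / 2 by [].
  have b3 : 3 < bound by rewrite bE; lra.
  have sR : s.*2%:R = n%:R - 1 :> R by rewrite nE -natr1; ring.
  apply: cactus_radius_le => //; [|lia..].
  have root : bound ^+ 2 - (n%:R + 2) * bound + (2 * n%:R - 2) = 0.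
    have -> : bound ^+ 2 - (n%:R + 2) * bound + (2 * n%:R - 2) =
      (d ^+ 2 - (n%:R ^+ 2 - 4 * n%:R + 12)) / 4 by rewrite bE; field.
    by rewrite d2 subrr mul0r.
  rewrite /H_value_eq sR mul0r addr0; apply/eqP; rewrite -subr_eq0.
  have -> : bound - (n%:R - 1) * (1 + (bound - 3)^-1) =
    (bound ^+ 2 - (n%:R + 2) * bound + (2 * n%:R - 2)) / (bound - 3).
    by field; lra.
  by rewrite root mul0r.
set s := (n./2 - 1)%N; have nE : n = s.*2.+2 by lia.
pose d := Num.sqrt (n%:R ^+ 2 - 2 * n%:R + 9 : R).
have d2 : d ^+ 2 = n%:R ^+ 2 - 2 * n%:R + 9 by rewrite sqr_sqrtr //; nra.
have d3 : 3 <= d by apply: sqrt_ge_sqr => //; nra.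
have bE : bound = (n%:R + 1 + d) / 2 by [].
have b3 : 3 < bound by rewrite bE; lra.
have sR : s.*2%:R = n%:R - 2 :> R by rewrite nE -!natr1; ring.
apply: cactus_radius_le => //; [|lia..].
have root : bound ^+ 2 - (n%:R + 1) * bound + (n%:R - 2) = 0.
  have -> : bound ^+ 2 - (n%:R + 1) * bound + (n%:R - 2) =
    (d ^+ 2 - (n%:R ^+ 2 - 2 * n%:R + 9)) / 4 by rewrite bE; field.
  by rewrite d2 subrr mul0r.
(* Clearing denominators in [H_value_eq] gives a cubic equation, of which 2 is
   the remaining root. *)
rewrite /H_value_eq sR mul1r; apply/eqP; rewrite -subr_eq0.
have -> : bound - ((n%:R - 2) * (1 + (bound - 3)^-1) + (1 + (bound - 1)^-1)) =
  (bound - 2) * (bound ^+ 2 - (n%:R + 1) * bound + (n%:R - 2)) /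
  ((bound - 3) * (bound - 1)).
  by field; lra.
by rewrite root mulr0 mul0r.
Qed.
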